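(* For every $p\in[2,\infty)$ and every $m,n\in\mathbb{N}$ there exists a $1$-Lipschitz function $F:\ell_2^n\to\ell_2^n(\ell_p^{m+1})$ such that for every $$r\geqslant\frac{32}{\sqrt{n}\,2^m},$$ every $y\in\ell_2^n$ with $y+rB_{\ell_2^n}\subseteq B_{\ell_2^n}$, and every affine mapping $A:\ell_2^n\to\ell_2^n(\ell_p^{m+1})$, $$\sup_{x\in y+rB_{\ell_2^n}}\frac{\|F(x)-A(x)\|_{\ell_2^n(\ell_p^{m+1})}}{r}>\frac{1}{16m^{1/p}} .$$ Consequently, if we set $\varepsilon=\frac{1}{16m^{1/p}}$, then for $X=\ell_2^n$ and $Y=\ell_2^n(\ell_p^{m+1})$, $$r^{X\to Y}(\varepsilon)\leqslant\frac{32}{\sqrt{n}\,2^{1/(16\varepsilon)^p}} .$$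
   Context: $\ell_2^n(\ell_p^{m+1})$ is the space of $n$-tuples $(u_1,\dots,u_n)$ with $u_i\in\ell_p^{m+1}$, normed by $\left(\sum_{i=1}^n\|u_i\|_p^2\right)^{1/2}$. $B_Z$ denotes the closed unit ball of a normed space $Z$. Modulus of affine approximability: let $X,Y$ be Banach spaces. For $\varepsilon\in(0,1)$, $r^{X\to Y}(\varepsilon)$ is the supremum over those $r\in(0,1]$ such that for every Lipschitz function $f:B_X\to Y$ there exist $y\in X$ and $\rho\in[r,\infty)$ with $y+\rho B_X\subseteq B_X$, and there exists an affine mapping $A:X\to Y$, such that $$\sup_{z\in y+\rho B_X}\frac{\|f(z)-A(z)\|}{\rho}\leqslant \varepsilon\|f\|_{\mathrm{Lip}},$$ where $\|f\|_{\mathrm{Lip}}$ is the Lipschitz constant of $f$. If no such $r\in(0,1]$ exists then $r^{X\to Y}(\varepsilon)=0$. *)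

(* Defs.v *)
From HB Require Import structures.
From mathcomp Require Import all_boot all_order all_algebra.
From mathcomp Require Import ring.
From mathcomp Require Import all_classical all_reals all_analysis.
Set Implicit Arguments.
Unset Strict Implicit.
Unset Printing Implicit Defensive.
Import Order.TTheory GRing.Theory Num.Theory.
Import numFieldNormedType.Exports.

Local Open Scope classical_set_scope.
Local Open Scope ring_scope.

(* [lpsum p1 n E] is the space of n-tuples of elements of E, normed by
   (\sum_i ||u_i||^p)^(1/p). The proof [p1] of 1 <= p is a parameter of the
   type because it is needed for the triangle inequality. *)
Definition lpsum (R : realType) (p : R) (p1 : 1 <= p) (n : nat)
  (E : normedModType R) : Type := {ffun 'I_n -> E}.

Lemma powR_convex_split (R : realType) (p a b x y : R) : 1 <= p ->
    0 < a -> 0 < b -> 0 <= x -> 0 <= y ->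
  (x + y) `^ p <=
  (a + b) `^ p * (a / (a + b) * (x / a) `^ p + b / (a + b) * (y / b) `^ p).
Proof.
move=> p1 a0 b0 x0 y0; have ab0 : 0 < a + b by exact: addr_gt0.
have t0 : 0 <= a / (a + b) by rewrite divr_ge0 ?(ltW a0) ?(ltW ab0).
have t1 : a / (a + b) <= 1 by rewrite ler_pdivrMr// mul1r lerDl (ltW b0).
pose t := Itv01 t0 t1.
have tE : t%:num = a / (a + b) by [].
have tcE : unstable.onem t%:num = b / (a + b).
  by rewrite tE /unstable.onem -(divff (lt0r_neq0 ab0)) -mulrBl addrAC subrr add0r.
have xa0 : 0 <= x / a by rewrite divr_ge0 ?(ltW a0).
have yb0 : 0 <= y / b by rewrite divr_ge0 ?(ltW b0).
have -> : x + y = (a + b) * (a / (a + b) * (x / a) + b / (a + b) * (y / b)).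
  by field; rewrite !gt_eqF.
rewrite powRM ?(ltW ab0)//; last first.
  by rewrite addr_ge0// mulr_ge0// divr_ge0 ?(ltW ab0) ?(ltW b0).
rewrite ler_wpM2l ?powR_ge0//.
have := @convex_powR R p p1 t (x / a) (y / b).
rewrite !inE/= !in_itv/= !andbT xa0 yb0 => /(_ isT isT).
rewrite [X in X `^ _ <= _ -> _]convRE [X in _ <= X -> _]convRE.
by rewrite tcE tE.
Qed.

Lemma sum_comb (R : realType) (n : nat) (a b c : R) (f g : 'I_n -> R) :
    a + b != 0 -> \sum_(i < n) f i = 1 -> \sum_(i < n) g i = 1 ->
  \sum_(i < n) c * (a / (a + b) * f i + b / (a + b) * g i) = c.
Proof.
move=> ab0 f1 g1; rewrite -mulr_sumr big_split/= -!mulr_sumr f1 g1 !mulr1.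
by rewrite -mulrDl divff// mulr1.
Qed.

Section lpsum_lmodType.
Context (R : realType) (p : R) (p1 : 1 <= p) (n : nat) (E : normedModType R).

HB.instance Definition _ :=
  GRing.Lmodule.copy (lpsum p1 n E) {ffun 'I_n -> E}.

End lpsum_lmodType.

Section lpsum_norm.
Context (R : realType) (p : R) (p1 : 1 <= p) (n : nat) (E : normedModType R).

Definition lpnorm (u : lpsum p1 n E) : R :=
  (\sum_(i < n) `|(u : {ffun 'I_n -> E}) i| `^ p) `^ p^-1.

Let p_gt0 : 0 < p. Proof. exact: lt_le_trans p1. Qed.
Let p_neq0 : p != 0. Proof. by rewrite gt_eqF. Qed.

Lemma lpnorm_ge0 u : 0 <= lpnorm u. Proof. exact: powR_ge0. Qed.

Lemma lpnorm_powR u :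
  lpnorm u `^ p = \sum_(i < n) `|(u : {ffun 'I_n -> E}) i| `^ p.
Proof.
by rewrite -powRrM mulVf// powRr1// sumr_ge0// => i _; exact: powR_ge0.
Qed.

Lemma lpnorm_le (u : lpsum p1 n E) (c : R) : 0 <= c ->
  (lpnorm u <= c) =
  (\sum_(i < n) `|(u : {ffun 'I_n -> E}) i| `^ p <= c `^ p).
Proof.
move=> c0; rewrite -lpnorm_powR; apply/idP/idP => h.
  by apply: ge0_ler_powR; rewrite ?nnegrE ?lpnorm_ge0 ?(ltW p_gt0).
rewrite leNgt; apply/negP => lt_c; move: h; apply/negP; rewrite -ltNge.
by apply: gt0_ltr_powR; rewrite // nnegrE ?lpnorm_ge0.
Qed.

Lemma lpnorm_coord (u : lpsum p1 n E) i :
  `|(u : {ffun 'I_n -> E}) i| <= lpnorm u.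
Proof.
rewrite leNgt; apply/negP => h.
have : lpnorm u `^ p < `|(u : {ffun 'I_n -> E}) i| `^ p.
  by apply: gt0_ltr_powR; rewrite // nnegrE ?lpnorm_ge0.
apply/negP; rewrite -leNgt lpnorm_powR (bigD1 i)//= lerDl.
by rewrite sumr_ge0// => j _; exact: powR_ge0.
Qed.

Lemma lpnorm0_eq0 u : lpnorm u = 0 -> u = 0.
Proof.
move=> u0; apply/ffunP => i; rewrite ffunE.
by apply/eqP; rewrite -normr_le0 -u0; exact: lpnorm_coord.
Qed.

Lemma lpnormZ (l : R) u : lpnorm (l *: u) = `|l| * lpnorm u.
Proof.
rewrite /lpnorm; under eq_bigr do rewrite ffunE normrZ powRM//.
rewrite -mulr_sumr powRM ?powR_ge0//; last first.
  by rewrite sumr_ge0// => i _; exact: powR_ge0.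
by rewrite -powRrM mulfV// powRr1.
Qed.

Lemma ler_lpnormD u v : lpnorm (u + v) <= lpnorm u + lpnorm v.
Proof.
have [/lpnorm0_eq0 -> | a0] := eqVneq (lpnorm u) 0.
  by rewrite add0r lerDr lpnorm_ge0.
have [/lpnorm0_eq0 -> | b0] := eqVneq (lpnorm v) 0.
  by rewrite addr0 lerDl lpnorm_ge0.
have {}a0 : 0 < lpnorm u by rewrite lt_neqAle eq_sym a0 lpnorm_ge0.
have {}b0 : 0 < lpnorm v by rewrite lt_neqAle eq_sym b0 lpnorm_ge0.
have ab0 := addr_gt0 a0 b0.
rewrite (lpnorm_le _ (ltW ab0)).
have le i : `|(u + v : {ffun 'I_n -> E}) i| `^ p <=
    (lpnorm u + lpnorm v) `^ p *
    (lpnorm u / (lpnorm u + lpnorm v) *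
       (`|(u : {ffun 'I_n -> E}) i| / lpnorm u) `^ p +
     lpnorm v / (lpnorm u + lpnorm v) *
       (`|(v : {ffun 'I_n -> E}) i| / lpnorm v) `^ p).
  apply: le_trans (powR_convex_split p1 a0 b0 (normr_ge0 _) (normr_ge0 _)).
  apply: (ge0_ler_powR (ltW p_gt0)).
  - exact: normr_ge0.
  - exact: addr_ge0 (normr_ge0 _) (normr_ge0 _).
  - by rewrite ffunE; exact: ler_normD.
apply: (le_trans (ler_sum _ (fun i _ => le i))).
have sum1 (w : lpsum p1 n E) : 0 < lpnorm w ->
    \sum_(i < n) (`|(w : {ffun 'I_n -> E}) i| / lpnorm w) `^ p = 1.
  move=> w0; under eq_bigr do rewrite powRM ?invr_ge0 ?lpnorm_ge0//.
  rewrite -mulr_suml -lpnorm_powR -powRM ?invr_ge0 ?lpnorm_ge0//.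
  by rewrite divff ?powR1// gt_eqF// powR_gt0.
by rewrite (sum_comb _ (lt0r_neq0 ab0) (sum1 u a0) (sum1 v b0)).
Qed.

HB.instance Definition _ := @Lmodule_isNormed.Build R (lpsum p1 n E)
  lpnorm ler_lpnormD lpnormZ lpnorm0_eq0.

Lemma lpsum_normE (u : lpsum p1 n E) :
  `|u| = (\sum_(i < n) `|(u : {ffun 'I_n -> E}) i| `^ p) `^ p^-1.
Proof. by []. Qed.

End lpsum_norm.

Section lpsum_complete.
Context (R : realType) (p : R) (p1 : 1 <= p) (n : nat)
  (E : completeNormedModType R).

Let X : normedModType R := lpsum p1 n E.

Lemma lpsum_complete (F : set_system X) : ProperFilter F -> cauchy F -> cvg F.
Proof.
move=> FF /cauchy_ballP Fc.
have Cc i : cauchy ((fun u : X => (u : {ffun 'I_n -> E}) i) @ F).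
  apply/cauchy_ballP => e e0; have [[A B] /= [FA FB] AB] := Fc _ e0.
  exists ((fun u : X => (u : {ffun 'I_n -> E}) i) @` A,
          (fun u : X => (u : {ffun 'I_n -> E}) i) @` B) => /=.
    by split; [apply: filterS FA | apply: filterS FB] => u /= ?; exists u.
  move=> [_ _] /= [[u Au <-] [v Bv <-]].
  have := AB (u, v) (conj Au Bv); rewrite /= -!ball_normE/=.
  apply: le_lt_trans; have := lpnorm_coord (u - v : lpsum p1 n E) i.
  by rewrite !ffunE.
pose l : X := [ffun i => lim ((fun u : X => (u : {ffun 'I_n -> E}) i) @ F)].
apply/cvg_ex; exists l; apply/cvgrPdist_le => /= e e0.
have p0 : 0 < p by exact: lt_le_trans p1.
have n0 : 0 < (n.+1%:R : R) `^ p^-1 by rewrite powR_gt0.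
pose d := e / (n.+1%:R : R) `^ p^-1.
have d0 : 0 < d by rewrite divr_gt0.
have H : \forall u \near F, forall i : 'I_n,
    `|(l : {ffun 'I_n -> E}) i - (u : {ffun 'I_n -> E}) i| <= d.
  apply: filter_forall => i; rewrite ffunE.
  have /cauchy_cvg/cvgrPdist_le := Cc i; exact.
apply: filterS H => u Hu.
rewrite -[X in X <= _]/(lpnorm (l - u : lpsum p1 n E)) (lpnorm_le _ (ltW e0)).
apply: (@le_trans _ _ (\sum_(i < n) d `^ p)).
  apply: ler_sum => i _; rewrite !ffunE; apply: ge0_ler_powR.
  - exact: ltW.
  - by rewrite nnegrE.
  - by rewrite nnegrE ltW.
  - by have := Hu i; rewrite ffunE.
have dE : d `^ p * n.+1%:R = e `^ p.
  have nE : n.+1%:R = (n.+1%:R `^ p^-1) `^ p :> R.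
    by rewrite -powRrM mulVf ?gt_eqF// powRr1.
  by rewrite [in LHS]nE -powRM ?(ltW d0) ?(ltW n0)// divfK ?gt_eqF.
rewrite sumr_const card_ord -dE mulr_natr; apply: ler_wpMn2l => //.
exact: powR_ge0.
Qed.

HB.instance Definition _ := Uniform_isComplete.Build (lpsum p1 n E)
  lpsum_complete.

End lpsum_complete.

Lemma le1_2 (R : realType) : 1 <= 2 :> R.
Proof. by rewrite ler1n. Qed.

Lemma le1_le2 (R : realType) (p : R) : 2 <= p -> 1 <= p.
Proof. exact: le_trans (le1_2 R). Qed.

Definition ellp (R : realType) (p : R) (p1 : 1 <= p) (n : nat) :
  completeNormedModType R := lpsum p1 n R^o.

Definition ell2 (R : realType) (n : nat) : completeNormedModType R :=
  ellp (le1_2 R) n.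

Definition ell2_ellp (R : realType) (n : nat) (p : R) (p1 : 1 <= p) (k : nat) :
  completeNormedModType R := lpsum (le1_2 R) n (ellp p1 k).

Section affine_approximability.
Context {R : realType} {X Y : completeNormedModType R}.

Definition affine_map (A : X -> Y) : Prop :=
  exists (L : {linear X -> Y}) (b : Y), forall x, A x = L x + b.

Definition unit_ball : set X := closed_ball 0 1.

(* The least Lipschitz constant of f on the unit ball; only the values of f
   on the unit ball matter, so f : B_X -> Y is encoded as a total function. *)
Definition lip_const (f : X -> Y) : R :=
  inf [set k | 0 <= k /\ k.-lipschitz_unit_ball f].

(* sup_(z in y + r B_X) ||f z - A z|| / r. It is extended-real valued since an
   affine map A need not be bounded on a ball. *)
Definition affine_error (f A : X -> Y) (y : X) (r : R) : \bar R :=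
  ereal_sup [set (`|f z - A z| / r)%:E | z in closed_ball y r].

Definition approximable_at_scale (eps r : R) : Prop :=
  forall f : X -> Y, [lipschitz f x | x in unit_ball] ->
    exists (y : X) (rho : R) (A : X -> Y),
      [/\ r <= rho, closed_ball y rho `<=` unit_ball, affine_map A &
          (affine_error f A y rho <= (eps * lip_const f)%:E)%E].

End affine_approximability.

(* [sup set0 = 0], which is the convention for the modulus when no r works. *)
Definition affine_modulus (R : realType) (X Y : completeNormedModType R)
    (eps : R) : R :=
  sup [set r | 0 < r <= 1 /\ @approximable_at_scale R X Y eps r].

(* Main.v *)
Require Import Defs.
From mathcomp Require Import all_boot all_order all_algebra.
From mathcomp Require Import ring lra.
From mathcomp Require Import all_classical all_reals all_analysis.
Import Order.TTheory GRing.Theory Num.Theory.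
Import numFieldNormedType.Exports.
Local Open Scope classical_set_scope.
Local Open Scope ring_scope.

(** The function F applies to every coordinate of ell_2^n the same curve
    multisaw : R -> ell_p^(m+1), whose k-th entry is (m+1)^(-1/p) times a
    sawtooth of slopes +1 and -1 and of scale s_k = 2^(-k) / sqrt n, for
    k = 0, ..., m.  Each sawtooth is 1-Lipschitz and the factor (m+1)^(-1/p)
    compensates for having m+1 of them, so the curve is 1-Lipschitz, and hence
    so is F.

    The obstruction to affine approximation is a second difference.  It
    vanishes on affine maps, so F(x+h) + F(x-h) - 2 F(x) has norm at most four
    times the error on any ball that contains x, x+h and x-h
    (affine_error_second_difference).  Fix a ball of centre y and radius r, a
    number j <= n of coordinates and a scale s = s_k.  Move each of the first j
    coordinates of y to the nearest valley of the sawtooth of scale s, and let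
    h be s on these j coordinates and 0 elsewhere.  At a valley the second
    difference of the sawtooth with step s is 2 s, so the second difference of
    F has norm at least 2 s sqrt j (m+1)^(-1/p).  The points x, x+h and x-h
    have coordinates at distance at most 2 s from those of y, so they lie in
    the ball when 2 s sqrt j <= r (affine_error_multisaw).

    It remains to have r < 4 s sqrt j as well, so that the relative error
    exceeds (m+1)^(-1/p) / 8 >= 1 / (16 m^(1/p)).  Neither parameter is enough
    alone: for r below 2 / sqrt n a single coordinate is used and the dyadic
    scale is adapted to r, while for larger r the coarsest scale is used and
    the number of coordinates is adapted to r (scale_selection).

    The bound on the modulus follows by testing its definition on F
    (affine_modulus_le). *)

Set Implicit Arguments.
Unset Strict Implicit.

(** * A sawtooth function *)

(** The point of 2 s Z nearest to t. *)
Definition valley {R : realType} (s t : R) : R :=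
  2 * s * (Num.floor (t / (2 * s) + 2^-1))%:~R.

Definition sawtooth {R : realType} (s t : R) : R := `|t - valley s t|.

Lemma sawtooth_le_scale (R : realType) (s t : R) : 0 < s -> sawtooth s t <= s.
Proof.
move=> s0; rewrite /sawtooth /valley.
have := floor_itv (t / (2 * s) + 2^-1); rewrite intrD.
set z := (Num.floor _)%:~R; set q := t / (2 * s) => /andP[zq qz].
have -> : t = 2 * s * q by rewrite /q; field; rewrite gt_eqF.
have : `|q - z| <= 2^-1 by rewrite ler_norml; lra.
by rewrite -mulrBr normrM gtr0_norm ?mulr_gt0//; nra.
Qed.

(** The interval is half-open because a peak, which is at distance s from two
    valleys, is assigned by the floor to the valley on its right. *)
Lemma valleyP (R : realType) (s a : R) (z : int) :
  0 < s -> - s <= a < s -> valley s (2 * s * z%:~R + a) = 2 * s * z%:~R.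
Proof.
move=> s0 /andP[sa a_s]; congr (_ * _%:~R); apply: floor_def.
have -> : (2 * s * z%:~R + a) / (2 * s) = z%:~R + a / (2 * s).
  by field; rewrite gt_eqF.
have aE : a = a / (2 * s) * (2 * s) by rewrite divfK// gt_eqF// mulr_gt0.
rewrite intrD; move: aE; set q := a / (2 * s) => aE; nra.
Qed.

Lemma sawtooth_near (R : realType) (s a : R) (z : int) :
  0 < s -> - s <= a < s -> sawtooth s (2 * s * z%:~R + a) = `|a|.
Proof. by move=> s0 sa; rewrite /sawtooth valleyP// addrAC subrr add0r. Qed.

Lemma sawtooth_valley (R : realType) (s t : R) :
  0 < s -> sawtooth s (valley s t) = 0.
Proof.
move=> s0; rewrite -[valley s t]addr0 sawtooth_near ?normr0//.
by rewrite s0 oppr_le0 ltW.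
Qed.

Lemma sawtooth_valleyB (R : realType) (s t : R) :
  0 < s -> sawtooth s (valley s t - s) = s.
Proof.
move=> s0; rewrite sawtooth_near ?normrN ?gtr0_norm//.
by rewrite lexx/= (lt_trans _ s0)// oppr_lt0.
Qed.

(** The peak on the right of a valley is handled from the next valley. *)
Lemma sawtooth_valleyD (R : realType) (s t : R) :
  0 < s -> sawtooth s (valley s t + s) = s.
Proof.
move=> s0; set z := Num.floor (t / (2 * s) + 2^-1).
have -> : valley s t + s = 2 * s * (z + 1)%:~R - s.
  by rewrite /valley -/z intrD; ring.
rewrite sawtooth_near ?normrN ?gtr0_norm//.
by rewrite lexx/= (lt_trans _ s0)// oppr_lt0.
Qed.

(** The sawtooth is the distance to 2 s Z; as for any distance to a set, this
    minimality yields the Lipschitz bound below. *)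
Lemma sawtooth_le_dist (R : realType) (s t : R) (z : int) :
  0 < s -> sawtooth s t <= `|t - 2 * s * z%:~R|.
Proof.
move=> s0; have [sz|zs] := leP s `|t - 2 * s * z%:~R|.
  by apply: le_trans sz; exact: sawtooth_le_scale.
rewrite -[X in sawtooth s X](subrK (2 * s * z%:~R)) addrC sawtooth_near//.
by move: zs; rewrite addrC ltr_norml => /andP[/ltW -> ->].
Qed.

Lemma sawtooth_lipschitz (R : realType) (s t t' : R) :
  0 < s -> `|sawtooth s t - sawtooth s t'| <= `|t - t'|.
Proof.
move=> s0; wlog le_tt : t t' / sawtooth s t' <= sawtooth s t => [W|].
  have [/W//|/ltW/W] := leP (sawtooth s t') (sawtooth s t).
  by rewrite distrC (distrC t').
rewrite ger0_norm ?subr_ge0// lerBlDr.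
apply: le_trans (sawtooth_le_dist t (Num.floor (t' / (2 * s) + 2^-1)) s0) _.
by apply: le_trans (ler_normD _ _); rewrite subrKA.
Qed.

(** * Norms in sums of normed spaces *)

Section lpsum_norm_comparison.
Context {R : realType} {p : R} (p1 : 1 <= p) (n : nat).

Lemma ler_lpsum_norm (E E' : normedModType R)
    (u : lpsum p1 n E) (v : lpsum p1 n E') :
  (forall i, `|(u : {ffun 'I_n -> E}) i| <= `|(v : {ffun 'I_n -> E'}) i|) ->
  `|u| <= `|v|.
Proof.
move=> uv; rewrite -[`|u|]/(lpnorm u) lpnorm_le// -[`|v|]/(lpnorm v).
rewrite lpnorm_powR; apply: ler_sum => i _.
by apply: ge0_ler_powR; rewrite ?nnegrE// (le_trans _ p1).
Qed.

(** Steps serve both as displacements and, through ler_lpsum_norm, as the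
    explicit vectors with which other norms are compared. *)
Definition step_vec (j : nat) (c : R) : ellp p1 n :=
  [ffun i : 'I_n => if (i < j)%N then c else 0].

Lemma norm_step_vec (j : nat) (c : R) : (j <= n)%N ->
  `|step_vec j c| = j%:R `^ p^-1 * `|c|.
Proof.
move=> jn; have p0 : p != 0 by rewrite gt_eqF// (lt_le_trans _ p1).
rewrite lpsum_normE.
have -> : \sum_(i < n) `|(step_vec j c : {ffun 'I_n -> R^o}) i| `^ p =
    j%:R * `|c| `^ p.
  under eq_bigr do rewrite ffunE.
  rewrite (bigID (fun i : 'I_n => (i < j)%N))/= [X in _ + X]big1 ?addr0.
    under eq_bigr => i -> do [].
    rewrite -(big_ord_widen _ (fun=> `|c| `^ p) jn) sumr_const card_ord.
    by rewrite mulr_natl.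
  by move=> i /negbTE ->; rewrite normr0 powR0.
by rewrite powRM ?powR_ge0// -powRrM mulfV// powRr1.
Qed.

End lpsum_norm_comparison.

Lemma norm_step_vec2 (R : realType) (n j : nat) (c : R) : (j <= n)%N ->
  `|step_vec (le1_2 R) n j c| = Num.sqrt j%:R * `|c|.
Proof. by move=> jn; rewrite norm_step_vec// powR12_sqrt. Qed.

Definition coordwise {R : realType} {p : R} (p1 : 1 <= p) (n : nat)
    {E E' : normedModType R} (f : E -> E') (x : lpsum p1 n E) : lpsum p1 n E' :=
  [ffun i => f ((x : {ffun 'I_n -> E}) i)].

Lemma coordwise_lipschitz (R : realType) (p : R) (p1 : 1 <= p) (n : nat)
    (E E' : normedModType R) (f : E -> E') :
  (forall a b, `|f a - f b| <= `|a - b|) ->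
  forall x y : lpsum p1 n E, `|coordwise f x - coordwise f y| <= `|x - y|.
Proof. by move=> fL x y; apply: ler_lpsum_norm => i; rewrite !ffunE. Qed.

(** * The multiscale sawtooth curve *)

Definition multisaw {R : realType} {p : R} (p1 : 1 <= p) (k : nat)
    (s : nat -> R) (t : R^o) : ellp p1 k :=
  [ffun l : 'I_k => k%:R `^ (- p^-1) * sawtooth (s l) t].

Lemma multisaw_lipschitz (R : realType) (p : R) (p1 : 1 <= p) (k : nat)
    (s : nat -> R) : (0 < k)%N -> (forall l, 0 < s l) ->
  forall a b, `|multisaw p1 k s a - multisaw p1 k s b| <= `|a - b|.
Proof.
move=> k0 s0 a b.
have kE : k%:R `^ p^-1 * k%:R `^ (- p^-1) = 1 :> R.
  by rewrite powRN divff// gt_eqF// powR_gt0// ltr0n.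
have -> : `|a - b| = `|step_vec p1 k k (k%:R `^ (- p^-1) * (a - b))|.
  by rewrite norm_step_vec// normrM ger0_norm ?powR_ge0// mulrA kE mul1r.
apply: ler_lpsum_norm => l; rewrite !ffunE ltn_ord -mulrBr !normrM.
by rewrite ler_wpM2l// sawtooth_lipschitz.
Qed.

(** * Second differences and affine approximation *)

Lemma affine_second_difference (R : realType) (X Y : completeNormedModType R)
    (A : X -> Y) (x h : X) : affine_map A -> A (x + h) + A (x - h) = A x *+ 2.
Proof.
move=> [L [b AE]]; rewrite !AE linearD linearB mulr2n addrACA.
by rewrite (addrACA (L x)) subrr addr0 addrACA.
Qed.

(** The second difference of f is that of f - A, which involves four values,
    counted with multiplicity, each bounded by r times the error. *)
Lemma affine_error_second_difference (R : realType)
    (X Y : completeNormedModType R) (f A : X -> Y) (y x h : X) (r : R) :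
  0 < r -> affine_map A ->
  closed_ball y r x -> closed_ball y r (x + h) -> closed_ball y r (x - h) ->
  ((`|f (x + h) + f (x - h) - f x *+ 2| / (4 * r))%:E <= affine_error f A y r)%E.
Proof.
move=> r0 Aaff xB xhB xh'B.
have ge z : closed_ball y r z ->
    ((`|f z - A z| / r)%:E <= affine_error f A y r)%E.
  by move=> zB; apply: ereal_sup_ubound; exists z.
move: (ge _ xB) (ge _ xhB) (ge _ xh'B).
case: (affine_error f A y r) => [e|_ _ _|]; [|exact: leey|by rewrite leeNy_eq].
rewrite !lee_fin !ler_pdivrMr ?mulr_gt0// => ex exh exh'.
have -> : f (x + h) + f (x - h) - f x *+ 2 =
    (f (x + h) - A (x + h)) + (f (x - h) - A (x - h)) - (f x - A x) *+ 2.
  rewrite mulrnBl -(affine_second_difference x h Aaff) (addrACA (f _)) -opprD.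
  by rewrite opprB addrA subrK.
apply: le_trans (ler_normB _ _) _; rewrite normrMn.
apply: le_trans (lerD (ler_normD _ _) (lexx _)) _; rewrite mulr2n; lra.
Qed.

(** * Approximating the sawtooth on a ball *)

Lemma step_mem_closed_ball (R : realType) (n j : nat) (s r : R) (y z : ell2 R n) :
    (j <= n)%N -> 0 < s -> 0 < r -> 2 * (Num.sqrt j%:R * s) <= r ->
    (forall i : 'I_n, `|(y - z : {ffun 'I_n -> R^o}) i| <=
                      if (i < j)%N then 2 * s else 0) ->
  closed_ball y r z.
Proof.
move=> jn s0 r0 jsr yz; rewrite closed_ballE// /closed_ball_/=.
apply: le_trans jsr.
have -> : 2 * (Num.sqrt j%:R * s) = `|step_vec (le1_2 R) n j (2 * s)|.
  by rewrite norm_step_vec2// ger0_norm ?mulr_ge0 ?(ltW s0)// mulrCA.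
apply: ler_lpsum_norm => i; apply: le_trans (yz i) _.
by rewrite !ffunE; case: ifP => // _; rewrite ler_norm.
Qed.

(** Only the l-th entries of the curve and the first j coordinates are used: at
    the valleys all j second differences have the same size and sign, and they
    add up in the Euclidean norm. *)
Lemma affine_error_multisaw (R : realType) (p : R) (p1 : 1 <= p) (n k j : nat)
    (s : nat -> R) (l : 'I_k) (y : ell2 R n) (r : R)
    (A : ell2 R n -> ell2_ellp n p1 k) :
    (j <= n)%N -> 0 < s l -> 0 < r -> 2 * (Num.sqrt j%:R * s l) <= r ->
    affine_map A ->
  ((Num.sqrt j%:R * s l / (2 * r) * k%:R `^ (- p^-1))%:E <=
   affine_error (coordwise (multisaw p1 k s) : ell2 R n -> ell2_ellp n p1 k) A y r)%E.
Proof.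
move=> jn s0 r0 jsr Aaff.
pose x : ell2 R n := [ffun i : 'I_n => if (i < j)%N
  then valley (s l) ((y : {ffun 'I_n -> R^o}) i) else (y : {ffun 'I_n -> R^o}) i].
pose h : ell2 R n := step_vec (le1_2 R) n j (s l).
have near (a : R) : `|a| <= s l -> closed_ball y r (x + step_vec (le1_2 R) n j a).
  move=> al; apply: (step_mem_closed_ball jn s0 r0 jsr) => i; rewrite !ffunE.
  case: ifP => _; last by rewrite addr0 subrr normr0.
  rewrite opprD addrA (le_trans (ler_normB _ _))//.
  rewrite [2 * _]mulr_natl mulr2n lerD//.
  exact: sawtooth_le_scale.
have hN : - h = step_vec (le1_2 R) n j (- s l).
  by apply/ffunP => i; rewrite !ffunE; case: ifP; rewrite ?oppr0.
have h0 : x = x + step_vec (le1_2 R) n j 0.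
  by apply/ffunP => i; rewrite !ffunE if_same addr0.
have xB : closed_ball y r x by rewrite h0; apply: near; rewrite normr0 ltW.
have xhB : closed_ball y r (x + h) by apply: near; rewrite gtr0_norm.
have xh'B : closed_ball y r (x - h).
  by rewrite hN; apply: near; rewrite normrN gtr0_norm.
apply: le_trans (affine_error_second_difference _ r0 Aaff xB xhB xh'B).
rewrite lee_fin.
set c : R := k%:R `^ (- p^-1).
have c0 : 0 <= c by exact: powR_ge0.
have -> : Num.sqrt j%:R * s l / (2 * r) * c =
    (Num.sqrt j%:R * `|2 * s l * c|) / (4 * r).
  rewrite ger0_norm ?mulr_ge0 ?(ltW s0)//; field; exact: lt0r_neq0.
rewrite ler_pM2r ?invr_gt0 ?mulr_gt0// -(@norm_step_vec2 _ n)//.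
apply: ler_lpsum_norm => i; rewrite !ffunE.
case: ifP => ij; last by rewrite normr0.
apply: le_trans (lpnorm_coord _ l); rewrite !ffunE.
rewrite sawtooth_valleyD// sawtooth_valleyB// sawtooth_valley//.
rewrite mulr0 -/c addr0 subr0.
by have -> : 2 * s l * c = c * s l + c * s l by ring.
Qed.

(** * Choice of the scale and of the number of coordinates *)

(** When v < 1, k is the least exponent with 2^(-k) <= v, and j = 1.  When
    v >= 1, k = 0 and j is the integer part of v^2, which is more than half of
    v^2; the bound v^2 <= n makes j coordinates available. *)
Lemma scale_selection (R : realType) (n m : nat) (v : R) : (0 < n)%N ->
    (2 ^+ m)^-1 <= v -> v ^+ 2 <= n%:R ->
  exists j k : nat, [/\ (0 < j <= n)%N, (k <= m)%N &
    Num.sqrt j%:R / 2 ^+ k <= v < 2 * (Num.sqrt j%:R / 2 ^+ k)].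
Proof.
move=> n0 mv vn; have v0 : 0 < v by apply: lt_le_trans mv; rewrite invr_gt0 exprn_gt0.
have [v1|v1] := leP 1 v.
  have v2 : 1 <= v ^+ 2 by rewrite expr_ge1// ltW.
  have /andP[jv vj] := truncn_itv (ltW (lt_le_trans ltr01 v2)).
  exists (Num.truncn (v ^+ 2)), 0%N; set j := Num.truncn _ in jv vj *.
  have j0 : (0 < j)%N by rewrite truncn_gt0.
  have jr : 1 <= j%:R :> R by rewrite ler1n.
  split=> //; first by rewrite j0 -(ler_nat R) (le_trans jv).
  have sj := sqr_sqrtr (ler0n R j); have s0 := sqrtr_ge0 (j%:R : R).
  rewrite expr0 divr1; apply/andP; split.
    by rewrite -(ler_sqr s0) ?sj// nnegrE ltW.
  rewrite -ltr_sqr ?nnegrE ?mulr_ge0//; last exact: ltW.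
  by rewrite exprMn sj (lt_le_trans vj)// -natr1; lra.
have ex : exists k, (2 ^+ k)^-1 <= v by exists m.
case: (ex_minnP ex) => k kv kmin; exists 1%N, k.
split=> //; first exact: kmin.
rewrite sqrtr1 mul1r kv/=.
case: k kv kmin => [|k] kv kmin; first by rewrite expr0 invr1 in kv *; lra.
rewrite exprS invfM mulrA divff ?mul1r// ltNge; apply/negP => /kmin.
by rewrite ltnn.
Qed.

(** * From the error to the modulus *)

Lemma radius_le1 (R : realType) (V : completeNormedModType R) (y e : V) (r : R) :
  0 < r -> `|e| = r -> closed_ball y r `<=` unit_ball -> r <= 1.
Proof.
move=> r0 er yr.
have in1 z : closed_ball y r z -> `|z| <= 1.
  by move=> /yr; rewrite /unit_ball closed_ballE// /closed_ball_/= sub0r normrN.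
have yeB : `|y + e| <= 1.
  by apply: in1; rewrite closed_ballE// /closed_ball_/= opprD addNKr normrN er.
have yeB' : `|y - e| <= 1.
  by apply: in1; rewrite closed_ballE// /closed_ball_/= subKr er.
have : `|e *+ 2| <= 2.
  have -> : e *+ 2 = (y + e) - (y - e) by rewrite opprB addrC addrA subrK.
  by rewrite (le_trans (ler_normB _ _))// -[2](natrD _ 1 1) lerD.
by rewrite normrMn er mulr2n; lra.
Qed.

(** A single badly approximated function bounds the modulus: a radius r > b in
    the defining set would give a ball of radius rho >= r > b on which f is
    approximated within eps times its Lipschitz constant, hence within eps. *)
Lemma affine_modulus_le (R : realType) (X Y : completeNormedModType R)
    (eps b : R) (f : X -> Y) : 0 <= eps -> 0 <= b -> 1.-lipschitz f ->
  (forall r : R, b <= r -> forall y : X, closed_ball y r `<=` unit_ball ->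
   forall A : X -> Y, affine_map A -> (eps%:E < affine_error f A y r)%E) ->
  affine_modulus X Y eps <= b.
Proof.
move=> eps0 b0 fL bad.
have fL1 : 1.-lipschitz_unit_ball f by move=> z _; exact: fL.
have B0 : (unit_ball `*` unit_ball) (0 : X, 0 : X).
  by split; rewrite /unit_ball closed_ballE// /closed_ball_/= subrr normr0.
have Bfilter := globally_properfilter B0.
have lip1 : lip_const f <= 1.
  by apply: ge_inf; [exists 0 => k []|split].
rewrite /affine_modulus; set S := [set r | _].
(* The supremum of the empty set is 0, which is below b. *)
have [->|/set0P S0] := eqVneq S set0; first by rewrite sup0.
apply: ge_sup => // r [/andP[r0 _] /(_ f (klipschitzW fL1))].
move=> [y [rho [A]]] [rrho yrho Aaff err]; rewrite leNgt; apply/negP => br.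
have /lt_le_trans/(_ err) := bad rho (le_trans (ltW br) rrho) y yrho A Aaff.
by rewrite lte_fin ltNge ler_piMr.
Qed.

(** m + 1 <= 2 m, and the factor 2^(1/p) is at most 2. *)
Lemma powR_invS_ge (R : realType) (p : R) (m : nat) : 1 <= p -> (0 < m)%N ->
  (2 * m%:R `^ p^-1)^-1 <= m.+1%:R `^ (- p^-1) :> R.
Proof.
move=> p1 m0; have p0 : 0 < p by apply: lt_le_trans p1.
have mr : 1 <= m%:R :> R by rewrite ler1n.
have mp : 0 < m%:R `^ p^-1 :> R by rewrite powR_gt0 ?ltr0n.
rewrite powRN lef_pV2 ?posrE ?mulr_gt0 ?powR_gt0 ?ltr0n//.
have h : m.+1%:R `^ p^-1 <= (2 * m%:R) `^ p^-1 :> R.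
  apply: ge0_ler_powR; rewrite ?nnegrE ?invr_ge0 ?(ltW p0)//.
  by rewrite -natr1; lra.
apply: le_trans h _; rewrite powRM// ler_wpM2r ?(ltW mp)//.
rewrite -[leRHS]powRr1//; apply: ler_powR; first by lra.
by rewrite invf_le1.
Qed.

Unset Implicit Arguments.
Set Strict Implicit.

Theorem lemma4p3 (R : realType) (p : R) (p2 : 2 <= p) (m n : nat)
    (m_gt0 : (0 < m)%N) (n_gt0 : (0 < n)%N) :
  (exists F : ell2 R n -> ell2_ellp n (le1_le2 p2) m.+1,
    1.-lipschitz F /\
    forall r : R, 32 / (Num.sqrt n%:R * 2 ^+ m) <= r ->
    forall y : ell2 R n, closed_ball y r `<=` unit_ball ->
    forall A : ell2 R n -> ell2_ellp n (le1_le2 p2) m.+1, affine_map A ->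
      ((1 / (16 * m%:R `^ (1 / p)))%:E < affine_error F A y r)%E) /\
  (let eps : R := 1 / (16 * m%:R `^ (1 / p)) in
   affine_modulus (ell2 R n) (ell2_ellp n (le1_le2 p2) m.+1) eps
     <= 32 / (Num.sqrt n%:R * 2 `^ (1 / (16 * eps) `^ p))).
Proof.
have p1 : 1 <= p := le1_le2 p2.
have p0 : 0 < p by apply: lt_le_trans p1.
have mp : 0 < m%:R `^ p^-1 :> R by rewrite powR_gt0 ?ltr0n.
have sn0 : 0 < Num.sqrt n%:R :> R by rewrite sqrtr_gt0 ltr0n.
have b0 : 0 < 32 / (Num.sqrt n%:R * 2 ^+ m) :> R.
  by rewrite divr_gt0 ?mulr_gt0 ?exprn_gt0.
rewrite [1 / p]div1r.
set part1 := (X in X /\ _).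
(* 16 eps is m^(-1/p), so the exponent of 2 in the second part is m. *)
suff H : part1.
  split=> //; case: H => F [FL bad] eps.
  have -> : 2 `^ (1 / (16 * eps) `^ p) = 2 ^+ m :> R.
    have -> : 16 * eps = m%:R `^ (- p^-1).
      by rewrite powRN /eps; field; exact: lt0r_neq0.
    rewrite -powRrM mulNr mulVf ?gt_eqF// powRN powRr1// div1r invrK.
    exact: powR_mulrn.
  apply: affine_modulus_le FL bad; last exact: ltW.
  by rewrite divr_ge0// mulr_ge0// ltW.
pose s k : R := (Num.sqrt n%:R * 2 ^+ k)^-1.
have s0 k : 0 < s k by rewrite invr_gt0 mulr_gt0 ?exprn_gt0.
exists (coordwise (multisaw p1 m.+1 s)); split.
  move=> [x y] _ /=; rewrite mul1r; apply: coordwise_lipschitz.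
  exact: multisaw_lipschitz.
move=> r br y yr A Aaff; have r0 : 0 < r by exact: lt_le_trans br.
have r1 : r <= 1.
  (* The assumption n > 0 provides a vector of norm r. *)
  apply: (@radius_le1 _ (ell2 R n) y (step_vec (le1_2 R) n 1 r)) => //.
  by rewrite norm_step_vec2// sqrtr1 mul1r gtr0_norm.
have sqn : Num.sqrt n%:R ^+ 2 = n%:R :> R by rewrite sqr_sqrtr.
(* Everything is rescaled by sqrt n / 2, which turns 2 s_k into 2^(-k). *)
have [j [k [/andP[j0 jn] km /andP[jv vj]]]] :
    exists j k : nat, [/\ (0 < j <= n)%N, (k <= m)%N &
    Num.sqrt j%:R / 2 ^+ k <= r * Num.sqrt n%:R / 2 < 2 * (Num.sqrt j%:R / 2 ^+ k)].
  apply: (@scale_selection _ n m) => //.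
    move: br; rewrite invfM mulrCA ler_pdivrMl// => br.
    have : 0 < (2 ^+ m)^-1 :> R by rewrite invr_gt0 exprn_gt0.
    by lra.
  have r2n : r ^+ 2 * n%:R <= n%:R by rewrite ler_piMl// expr_le1// ltW.
  have := mulr_ge0 (sqr_ge0 r) (ler0n R n).
  by rewrite !exprMn sqn expr2 in r2n *; lra.
have jsE : Num.sqrt j%:R * s k = Num.sqrt j%:R / 2 ^+ k / Num.sqrt n%:R.
  by rewrite /s invfM mulrA mulrAC.
have jsr : 2 * (Num.sqrt j%:R * s k) <= r.
  by rewrite jsE mulrA ler_pdivrMr//; lra.
have rjs : r < 4 * (Num.sqrt j%:R * s k).
  by rewrite jsE mulrA ltr_pdivlMr//; lra.
have km' : (k < m.+1)%N by [].
have /= := affine_error_multisaw (l := Ordinal km') y jn (s0 k) r0 jsr Aaff.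
apply: lt_le_trans; rewrite lte_fin.
have c_ge := powR_invS_ge p1 m_gt0.
have cE : 1 / (16 * m%:R `^ p^-1) = 8^-1 * (2 * m%:R `^ p^-1)^-1 :> R.
  by field; rewrite gt_eqF.
have c0 : 0 < (2 * m%:R `^ p^-1)^-1 :> R by rewrite invr_gt0 mulr_gt0.
rewrite cE; apply: (@lt_le_trans _ _
  (Num.sqrt j%:R * s k / (2 * r) * (2 * m%:R `^ p^-1)^-1)).
  by rewrite ltr_pM2r// ltr_pdivlMr ?mulr_gt0//; lra.
by rewrite ler_wpM2l// divr_ge0 ?mulr_ge0 ?sqrtr_ge0 ?(ltW (s0 k)) ?(ltW r0).
Qed.
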